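(* $$\int_0^{\infty} e^{-W(x)^2}\,dx = \sqrt[4]{e}\left[\frac{3\sqrt{\pi}}{4}+\frac{e^{-1/4}}{2}-\frac{3\sqrt{\pi}}{4}\,\mathrm{erf}\!\left(-\frac{1}{2}\right)\right].$$
   Context: $W$ is the Lambert W function (product logarithm): for $x\ge 0$, $W(x)$ is the unique real $w\ge 0$ with $we^{w}=x$. The error function is $\mathrm{erf}(x)=\frac{2}{\sqrt{\pi}}\int_0^x e^{-t^2}\,dt$. *)

(* Defs.v *)
From Stdlib Require Import Reals Lra.
From Coquelicot Require Import Coquelicot.
Open Scope R_scope.

(* The principal real branch, meaningful for [0 <= x] only; [iota] is
   Coquelicot's definite description ("the unique w such that ..."). *)
Definition lambertW (x : R) : R :=
  iota (fun w : R => 0 <= w /\ w * exp w = x).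

(* [RInt] is the oriented integral, so this also covers [x < 0]. *)
Definition erf (x : R) : R :=
  2 / sqrt PI * RInt (fun t => exp (- t ^ 2)) 0 x.

Lemma lambertW_exists_unique (x : R) :
  0 <= x -> exists! w : R, 0 <= w /\ w * exp w = x.
Proof.
intros Hx.
assert (Hlt : forall a b, 0 <= a -> a < b -> a * exp a < b * exp b).
{ intros a b Ha Hab.
  pose proof (exp_increasing a b Hab); pose proof (exp_pos a); nra. }
assert (Hex : exists w, 0 <= w /\ w * exp w = x).
{ destruct (IVT_gen (fun w => w * exp w) 0 x x) as [w [Hw Ew]].
  - intros w; apply derivable_continuous_pt.
    apply derivable_pt_mult; [apply derivable_pt_id | apply derivable_pt_exp].
  - pose proof (exp_ineq1_le x).
    rewrite Rmin_left, Rmax_right by nra; split; nra.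
  - exists w; split; [|exact Ew].
    rewrite Rmin_left in Hw by lra; tauto. }
destruct Hex as [w [Hw Ew]].
exists w; split; [split; assumption|].
intros v [Hv Ev].
destruct (Rtotal_order w v) as [H | [H | H]]; [|exact H|].
- pose proof (Hlt w v Hw H); lra.
- pose proof (Hlt v w Hv H); lra.
Qed.

Lemma lambertW_spec (x : R) :
  0 <= x -> 0 <= lambertW x /\ lambertW x * exp (lambertW x) = x.
Proof.
intros Hx.
exact (iota_correct (fun w : R => 0 <= w /\ w * exp w = x)
         (lambertW_exists_unique x Hx)).
Qed.

(* Main.v *)
(** The substitution [x = w * exp w] turns the integral into that of
    [(1 + w) * exp (w - w ^ 2)] over [0, +oo).  Completing the square,
    [w - w ^ 2 = 1 / 4 - (w - 1 / 2) ^ 2], gives an explicit primitive in terms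
    of the Gaussian integral.  The latter tends to [sqrt PI / 2] because
    [(int_0^x exp (- t ^ 2) dt) ^ 2
       + int_0^1 exp (- x ^ 2 * (1 + t ^ 2)) / (1 + t ^ 2) dt]
    has zero derivative in [x], equals [atan 1 = PI / 4] at [x = 0], and its
    second term vanishes as [x] tends to infinity. *)
Require Import Defs.
From Stdlib Require Import Reals Lra ssreflect.
From Coquelicot Require Import Coquelicot.
Open Scope R_scope.

(** * The Gaussian integral *)

Definition gauss (x : R) : R := RInt (fun t => exp (- t ^ 2)) 0 x.

Lemma continuous_gauss_density (x : R) : continuous (fun t => exp (- t ^ 2)) x.
Proof. apply: ex_derive_continuous; auto_derive; auto. Qed.

Lemma is_derive_gauss (x : R) : is_derive gauss x (exp (- x ^ 2)).
Proof.
apply: (is_derive_RInt (fun t => exp (- t ^ 2)) _ 0); [|apply continuous_gauss_density].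
apply filter_forall; intros b; apply: RInt_correct; apply: ex_RInt_continuous.
intros z _; apply continuous_gauss_density.
Qed.

Definition gauss_kernel (x t : R) : R := exp (- x ^ 2 * (1 + t ^ 2)) / (1 + t ^ 2).

(** The denominator cancels the factor [1 + t ^ 2] that the chain rule brings down. *)
Lemma is_derive_gauss_kernel (x t : R) :
  is_derive (fun u => gauss_kernel u t) x (-2 * x * exp (- x ^ 2 * (1 + t ^ 2))).
Proof.
assert (0 < 1 + t ^ 2) by nra.
unfold gauss_kernel; auto_derive; [auto|]; field_simplify; [f_equal; ring | lra].
Qed.

Lemma ex_RInt_gauss_kernel (x : R) : ex_RInt (gauss_kernel x) 0 1.
Proof.
apply: ex_RInt_continuous; intros z _.
apply: ex_derive_continuous; unfold gauss_kernel; auto_derive; nra.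
Qed.

(** Differentiating under the integral sign leaves [exp (- x ^ 2)] times the integral of
    [-2 * x * exp (- (x * t) ^ 2)] over [0, 1], and [s = x * t] turns the latter into [gauss x]. The
    result is the opposite of the derivative of [gauss x ^ 2]. *)
Lemma is_derive_RInt_gauss_kernel (x : R) :
  is_derive (fun u => RInt (gauss_kernel u) 0 1) x (-2 * exp (- x ^ 2) * gauss x).
Proof.
assert (E : RInt (fun t => Derive (fun u => gauss_kernel u t) x) 0 1 =
            -2 * exp (- x ^ 2) * gauss x).
{ unfold gauss.
  (* The bounds [0] and [x] take the shape [x * 0 + 0] and [x * 1 + 0] of an affine substitution. *)
  rewrite <- (Rmult_0_r x) at 2; rewrite <- (Rmult_1_r x) at 3.
  rewrite <- (Rplus_0_r (x * 0)), <- (Rplus_0_r (x * 1)).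
  rewrite <- RInt_comp_lin.
  2: { apply: ex_RInt_continuous; intros z _; apply continuous_gauss_density. }
  transitivity (scal (-2 * exp (- x ^ 2))
    (RInt (fun y => scal x (exp (- (x * y + 0) ^ 2))) 0 1)); [|reflexivity].
  rewrite <- RInt_scal.
  2: { apply: ex_RInt_continuous; intros z _; apply: ex_derive_continuous.
       unfold scal; simpl; unfold mult; simpl; auto_derive; auto. }
  apply RInt_ext; intros t _.
  rewrite (is_derive_unique _ _ _ (is_derive_gauss_kernel x t)).
  unfold scal; simpl; unfold mult; simpl.
  replace (- (x * (x * 1)) * (1 + t * (t * 1)))
    with (- (x * (x * 1)) + - ((x * t + 0) * ((x * t + 0) * 1))) by ring.
  rewrite exp_plus; ring. }
rewrite <- E.
apply is_derive_RInt_param.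
- apply filter_forall; intros u t _; eexists; apply is_derive_gauss_kernel.
- intros t _.
  apply continuity_2d_pt_ext with (fun u v => (-2 * u) * exp (- (u * u * (1 + v * v)))).
  { intros u v; rewrite (is_derive_unique _ _ _ (is_derive_gauss_kernel u v)).
    f_equal; f_equal; ring. }
  assert (Hu := continuity_2d_pt_id1 x t); assert (Hv := continuity_2d_pt_id2 x t).
  assert (Hc := fun c => continuity_2d_pt_const x t c).
  apply continuity_2d_pt_mult; [now apply continuity_2d_pt_mult|].
  apply (continuity_1d_2d_pt_comp exp);
    [apply derivable_continuous_pt, derivable_pt_exp|].
  apply continuity_2d_pt_opp; apply continuity_2d_pt_mult;
    [now apply continuity_2d_pt_mult|].
  apply continuity_2d_pt_plus; [auto | now apply continuity_2d_pt_mult].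
- apply filter_forall; intros y; apply ex_RInt_gauss_kernel.
Qed.

Lemma RInt_gauss_kernel_0 : RInt (gauss_kernel 0) 0 1 = PI / 4.
Proof.
apply is_RInt_unique.
apply is_RInt_ext with (fun t => / (1 + t ^ 2)).
{ intros t _; unfold gauss_kernel.
  replace (- 0 ^ 2 * (1 + t ^ 2)) with 0 by ring.
  unfold Rdiv; now rewrite exp_0 Rmult_1_l. }
replace (PI / 4) with (minus (atan 1) (atan 0)).
2: { now rewrite atan_1 atan_0 minus_zero_r. }
apply: is_RInt_derive; intros t _.
- apply is_derive_Reals.
  apply derivable_pt_lim_atan.
- apply: ex_derive_continuous; auto_derive; nra.
Qed.

Lemma gauss_sqr (x : R) : 0 <= x -> gauss x ^ 2 = PI / 4 - RInt (gauss_kernel x) 0 1.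
Proof.
(* Constancy is applied on a nondegenerate interval, so [x = 0] is separate. *)
intros [Hx | <-].
2: { rewrite RInt_gauss_kernel_0; unfold gauss; rewrite RInt_point; unfold zero; simpl; ring. }
rewrite <- RInt_gauss_kernel_0.
enough (gauss 0 ^ 2 + RInt (gauss_kernel 0) 0 1 = gauss x ^ 2 + RInt (gauss_kernel x) 0 1) as E.
{ unfold gauss in E at 1; rewrite RInt_point in E; unfold zero in E; simpl in E |- *; lra. }
apply (eq_is_derive (fun u => gauss u ^ 2 + RInt (gauss_kernel u) 0 1)); [|exact Hx].
intros t _.
(* Zero is split into the two opposite derivatives, the first in the shape given by the power
   rule. *)
replace (@zero R_NormedModule) with
  (plus (INR 2 * exp (- t ^ 2) * gauss t ^ pred 2) (-2 * exp (- t ^ 2) * gauss t)).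
2: { unfold plus, zero; simpl; ring. }
apply: is_derive_plus; [|apply is_derive_RInt_gauss_kernel].
apply is_derive_pow, is_derive_gauss.
Qed.

Lemma exp_le_mono (x y : R) : x <= y -> exp x <= exp y.
Proof.
intros [H | ->]; [left; now apply exp_increasing | right; reflexivity].
Qed.

Lemma exp_opp_sqr_le (x : R) : 0 < x -> exp (- x ^ 2) <= / x.
Proof.
intros Hx; rewrite exp_Ropp; apply Rinv_le_contravar; [exact Hx|].
pose proof (exp_ineq1_le (x ^ 2)); nra.
Qed.

Lemma is_lim_Rinv_p : is_lim Rinv p_infty 0.
Proof.
apply (is_lim_inv (fun x => x) p_infty p_infty); [apply is_lim_id | discriminate].
Qed.

Lemma is_lim_gauss_density : is_lim (fun x => exp (- x ^ 2)) p_infty 0.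
Proof.
apply (is_lim_le_le_loc (fun _ => 0) Rinv).
- exists 0; intros y Hy; split; [left; apply exp_pos | now apply exp_opp_sqr_le].
- apply is_lim_const.
- apply is_lim_Rinv_p.
Qed.

(** The upper bound is uniform in [t], so it survives integration over [0, 1] and squeezes the
    second term to 0. *)
Lemma gauss_kernel_bounds (x t : R) : 0 <= gauss_kernel x t <= exp (- x ^ 2).
Proof.
unfold gauss_kernel.
assert (H : 0 < / (1 + t ^ 2) <= 1).
{ split; [apply Rinv_0_lt_compat; nra|].
  rewrite <- Rinv_1 at 2; apply Rinv_le_contravar; nra. }
assert (exp (- x ^ 2 * (1 + t ^ 2)) <= exp (- x ^ 2)) by (apply exp_le_mono; nra).
pose proof (exp_pos (- x ^ 2 * (1 + t ^ 2))).
unfold Rdiv; nra.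
Qed.

Lemma is_lim_gauss : is_lim gauss p_infty (sqrt PI / 2).
Proof.
replace (sqrt PI / 2) with (sqrt (PI / 4 - 0)).
2: { rewrite Rminus_0_r sqrt_div_alt; [|lra].
     replace 4 with (2 * 2) by ring; rewrite sqrt_square; lra. }
apply is_lim_ext_loc with (fun x => sqrt (PI / 4 - RInt (gauss_kernel x) 0 1)).
(* For positive [x], [gauss x] is nonnegative, hence the square root of its square. *)
{ exists 0; intros x Hx; rewrite <- gauss_sqr by lra.
  apply sqrt_pow2; apply RInt_ge_0; [lra | | intros; left; apply exp_pos].
  apply: ex_RInt_continuous; intros z _; apply continuous_gauss_density. }
apply (is_lim_comp_continuous (fun x => PI / 4 - RInt (gauss_kernel x) 0 1) sqrt).
2: { apply continuity_pt_filterlim, continuity_pt_sqrt; pose proof PI_RGT_0; lra. }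
apply (is_lim_minus' (fun _ => PI / 4)); [apply is_lim_const|].
apply (is_lim_le_le_loc (fun _ => 0) (fun x => exp (- x ^ 2)));
  [| apply is_lim_const | apply is_lim_gauss_density].
exists 0; intros x _; split.
- apply RInt_ge_0; [lra | apply ex_RInt_gauss_kernel | intros; apply gauss_kernel_bounds].
- replace (exp (- x ^ 2)) with (RInt (fun _ => exp (- x ^ 2)) 0 1).
  + apply RInt_le; [lra | apply ex_RInt_gauss_kernel | apply ex_RInt_const |
      intros; apply gauss_kernel_bounds].
  + rewrite RInt_const; unfold scal; simpl; unfold mult; simpl; ring.
Qed.

(** * Regularity and growth of the Lambert function *)

Lemma lambertW_mul_exp (w : R) : 0 <= w -> lambertW (w * exp w) = w.
Proof.
intros Hw.
assert (Hx : 0 <= w * exp w) by (pose proof (exp_pos w); nra).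
destruct (lambertW_exists_unique _ Hx) as [v [_ Hv]].
rewrite <- (Hv _ (lambertW_spec _ Hx)); apply Hv; auto.
Qed.

(* The inverse [w * exp w] expands distances on [0, +oo). *)
Lemma lambertW_increase (x y : R) :
  0 <= x <= y -> 0 <= lambertW y - lambertW x <= y - x.
Proof.
intros [Hx Hxy].
destruct (lambertW_spec x Hx) as [Hv Ev].
destruct (lambertW_spec y ltac:(lra)) as [Hw Ew].
set (v := lambertW x) in *; set (w := lambertW y) in *.
pose proof (exp_ineq1_le v); pose proof (exp_ineq1_le w).
(* Here [y - x = w * (exp w - exp v) + (w - v) * exp v] with [exp v >= 1]; the case [w < v] would
   give [y < x]. *)
destruct (Rle_or_lt v w) as [Hvw | Hwv].
- pose proof (exp_le_mono v w Hvw); nra.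
- pose proof (exp_increasing w v Hwv); nra.
Qed.

(* Beyond [0 <= x] the value of [lambertW] is junk, hence the truncation. *)
Lemma continuous_lambertW_trunc (x : R) : continuous (fun t => lambertW (Rmax 0 t)) x.
Proof.
apply filterlim_locally; intros eps; exists eps; intros y Hy.
change (Rabs (y - x) < eps) in Hy.
change (Rabs (lambertW (Rmax 0 y) - lambertW (Rmax 0 x)) < eps).
apply: (Rle_lt_trans _ _ _ _ Hy).
assert (L : forall a b, a <= b ->
  Rabs (lambertW (Rmax 0 b) - lambertW (Rmax 0 a)) <= Rabs (b - a)).
{ intros a b Hab.
  assert (H : 0 <= Rmax 0 a <= Rmax 0 b /\ Rmax 0 b - Rmax 0 a <= b - a).
  { unfold Rmax; repeat destruct Rle_dec; lra. }
  pose proof (lambertW_increase _ _ (proj1 H)).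
  rewrite !Rabs_pos_eq; lra. }
destruct (Rle_or_lt x y) as [H | H]; [now apply L|].
rewrite (Rabs_minus_sym (lambertW _)) (Rabs_minus_sym y); apply L; lra.
Qed.

Lemma is_lim_lambertW : is_lim lambertW p_infty p_infty.
Proof.
apply is_lim_spec; intros M.
(* A nonnegative [m] above [M] is the value of [lambertW] at [m * exp m]; monotonicity does the
   rest. *)
set (m := Rmax 0 M + 1).
assert (Hm : 0 <= m /\ M < m) by (unfold m, Rmax; destruct Rle_dec; lra).
exists (m * exp m); intros x Hx.
assert (0 <= m * exp m) by (pose proof (exp_pos m); nra).
pose proof (lambertW_increase (m * exp m) x ltac:(lra)) as L.
rewrite (lambertW_mul_exp m) in L; lra.
Qed.

(** * The substitution and the improper integral *)

Definition subst_primitive (w : R) : R :=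
  exp (1 / 4) * (3 / 2 * gauss (w - 1 / 2) - exp (- (w - 1 / 2) ^ 2) / 2).

(** With [u = w - 1 / 2], the factor [1 + w] is [3 / 2 + u]: the constant yields the [gauss] term,
    and [u * exp (- u ^ 2)] integrates to [- exp (- u ^ 2) / 2]. *)
Lemma is_derive_subst_primitive (w : R) :
  is_derive subst_primitive w ((1 + w) * exp w * exp (- w ^ 2)).
Proof.
unfold subst_primitive; auto_derive.
{ eexists; apply is_derive_gauss. }
rewrite (is_derive_unique _ _ _ (is_derive_gauss _)).
replace ((1 + w) * exp w * exp (- w ^ 2))
  with (exp (1 / 4) * ((1 + w) * exp (- (w + - (1 / 2)) ^ 2))).
2: { rewrite <- Rmult_assoc, (Rmult_comm (exp (1 / 4))), !Rmult_assoc, <- !exp_plus.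
     do 2 f_equal; field. }
simpl; field.
Qed.

Lemma is_RInt_lambertW (b : R) : 0 <= b ->
  is_RInt (fun x => exp (- lambertW x ^ 2)) 0 b (subst_primitive (lambertW b) - subst_primitive 0).
Proof.
intros Hb.
(* Truncation makes the integrand continuous on both sides of the endpoint 0. *)
set (f := fun x => exp (- lambertW (Rmax 0 x) ^ 2)).
assert (Hf : forall x, continuous f x).
{ intros x; apply (continuous_comp (fun t => lambertW (Rmax 0 t)) (fun w => exp (- w ^ 2)));
    [apply continuous_lambertW_trunc | apply continuous_gauss_density]. }
apply is_RInt_ext with f.
{ intros x; rewrite Rmin_left; [|lra]; intros [Hx _].
  unfold f; rewrite Rmax_right; [reflexivity | lra]. }
destruct (lambertW_spec b Hb) as [Hw Ew].
replace (subst_primitive (lambertW b) - subst_primitive 0) with (RInt f 0 b).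
{ apply: RInt_correct; apply: ex_RInt_continuous; auto. }
(* Substituting along [w * exp w] differentiates only this map; [lambertW] need only be
   continuous. *)
transitivity (RInt f (0 * exp 0) (lambertW b * exp (lambertW b))).
{ now rewrite Rmult_0_l Ew. }
rewrite <- (RInt_comp f (fun w => w * exp w) (fun w => (1 + w) * exp w)).
- apply is_RInt_unique.
  apply is_RInt_ext with (fun w => (1 + w) * exp w * exp (- w ^ 2)).
  { intros w; rewrite Rmin_left; [|lra]; intros [H0 _].
    unfold f; rewrite Rmax_right; [|pose proof (exp_pos w); nra].
    rewrite lambertW_mul_exp; [reflexivity | lra]. }
  apply: is_RInt_derive; intros w _; [apply is_derive_subst_primitive|].
  apply: ex_derive_continuous; auto_derive; auto.
- auto.
- intros w _; split; [auto_derive; auto; ring|].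
  apply: ex_derive_continuous; auto_derive; auto.
Qed.

Lemma is_lim_subst_primitive : is_lim subst_primitive p_infty (exp (1 / 4) * (3 / 2 * (sqrt PI / 2))).
Proof.
assert (Hs : is_lim (fun w => w - 1 / 2) p_infty p_infty).
{ apply is_lim_spec; intros M; exists (M + 1); intros x Hx; lra. }
assert (Hc : forall f l, is_lim f p_infty l ->
  is_lim (fun w => f (w - 1 / 2)) p_infty l).
{ intros f l Hf; apply (is_lim_comp f _ p_infty l p_infty); auto.
  exists 0; discriminate. }
apply (is_lim_scal_l _ (exp (1 / 4)) p_infty (3 / 2 * (sqrt PI / 2))).
replace (3 / 2 * (sqrt PI / 2)) with (3 / 2 * (sqrt PI / 2) - / 2 * 0) by ring.
apply is_lim_minus'.
- apply (is_lim_scal_l _ (3 / 2) p_infty (sqrt PI / 2)), Hc, is_lim_gauss.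
- apply is_lim_ext with (fun w => / 2 * exp (- (w - 1 / 2) ^ 2)).
  { intros; field. }
  apply (is_lim_scal_l _ (/ 2) p_infty 0), (Hc (fun w => exp (- w ^ 2))),
    is_lim_gauss_density.
Qed.

Lemma erf_gauss (x : R) : sqrt PI * erf x = 2 * gauss x.
Proof.
unfold erf, gauss; field.
pose proof (sqrt_lt_R0 PI PI_RGT_0); lra.
Qed.

Theorem theorem3p2 :
  is_RInt_gen (fun x : R => exp (- (lambertW x) ^ 2))
    (at_point 0) (Rbar_locally p_infty)
    (Rpower (exp 1) (1 / 4) *
       (3 * sqrt PI / 4 + exp (- (1 / 4)) / 2
          - 3 * sqrt PI / 4 * erf (- (1 / 2)))).
Proof.
assert (Hl : is_lim (fun b => subst_primitive (lambertW b) - subst_primitive 0) p_infty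
  (exp (1 / 4) * (3 / 2 * (sqrt PI / 2)) - subst_primitive 0)).
{ apply is_lim_minus'; [|apply is_lim_const].
  apply (is_lim_comp subst_primitive lambertW p_infty _ p_infty);
    [apply is_lim_subst_primitive | apply is_lim_lambertW | exists 0; discriminate]. }
replace (Rpower (exp 1) (1 / 4) * (3 * sqrt PI / 4 + exp (- (1 / 4)) / 2
    - 3 * sqrt PI / 4 * erf (- (1 / 2))))
  with (exp (1 / 4) * (3 / 2 * (sqrt PI / 2)) - subst_primitive 0).
2: { unfold Rpower, subst_primitive; rewrite ln_exp Rmult_1_r.
     replace (3 * sqrt PI / 4 * erf (- (1 / 2)))
       with (3 / 4 * (sqrt PI * erf (- (1 / 2)))) by field.
     rewrite erf_gauss.
     (* The lower limit [w = 0] is shifted to [- (1 / 2)], the source of the [erf] and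
        [exp (- (1 / 4))] terms. *)
     replace (0 - 1 / 2) with (- (1 / 2)) by ring.
     replace (- (- (1 / 2)) ^ 2) with (- (1 / 4)) by field.
     field. }
intros P HP.
destruct (Hl P HP) as [M HM].
(* The threshold [Rmax 0 M] ensures both [0 <= b], for the finite integral, and [M < b], for the
   limit. *)
apply Filter_prod with (Q := eq 0) (R := fun b => Rmax 0 M < b).
- reflexivity.
- now exists (Rmax 0 M).
- intros a b <- Hb; simpl.
  pose proof (Rmax_l 0 M); pose proof (Rmax_r 0 M).
  eexists; split; [apply is_RInt_lambertW; lra | apply HM; lra].
Qed.
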